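(* Let $K$ be a field and let $G$ be a finite simple graph without isolated vertices, and let $b_0(G)$ be the number of its connected components. Then $$\operatorname{reg} I(X_G) \leq \begin{cases} |V_G|-b_0(G), & \text{if } G \text{ is bipartite},\\ |V_G|-b_0(G)+1, & \text{if } G \text{ is non-bipartite}.\end{cases}$$
   Context: Graphs have nonempty vertex set. For a graph $G$ with vertex set $V_G$ and edge set $E_G$, let $K[V_G]=K[x_i: i\in V_G]$ and $K[E_G]=K[t_e: e\in E_G]$ be standard graded polynomial rings, and let $\theta\colon K[E_G]\to K[V_G]$ be the $K$-algebra homomorphism with $\theta(t_e)=x_ix_j$ for each edge $e=\{i,j\}$. The ideal $I(X_G)\subseteq K[E_G]$ is the (homogeneous) ideal $I(X_G)=\theta^{-1}\big((x_i^2-x_j^2 : i,j\in V_G)\big)$. The Castelnuovo--Mumford regularity of a finitely generated graded module $M$ over a polynomial ring is $\operatorname{reg} M=\max\{j-i : \beta_{ij}\neq 0\}$, where $\beta_{ij}$ are the graded Betti numbers of $M$; for ideals, $\operatorname{reg} I(X_G)=\operatorname{reg} K[E_G]/I(X_G)+1$ (in particular $\operatorname{reg} I(X_G)=1$ when $I(X_G)=(0)$). *)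

(* Defs.v *)
From mathcomp Require Import all_boot all_order all_algebra.
From mathcomp Require Import boolp classical_sets.
From mathcomp Require Import mpoly.

Set Implicit Arguments.
Unset Strict Implicit.
Unset Printing Implicit Defensive.

Import Order.TTheory GRing.Theory Num.Theory.

Local Open Scope classical_set_scope.
Local Open Scope ring_scope.

Section Regularity.
Variables (K : fieldType) (n : nat).
Local Notation S := {mpoly K[n]}.

(* [p] lies in the graded component S_(a - b), which is zero when a < b: this
   is what an entry of a degree 0 map S(-a) -> S(-b) must satisfy. *)
Definition homog_shift (a b : nat) (p : S) : bool :=
  if (b <= a)%N then p \is (a - b)%N.-homog else p == 0.

(* The data of a complex of finitely generated graded free S-modules
     ... -> F_2 -> F_1 -> F_0 -> S/I,   F_i = \bigoplus_k S(- gdeg i k).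
   Elements of F_i are row vectors and maps act by multiplication on the right.
   The augmentation is given by representatives in S of the images in S/I of
   the basis of F_0. Natural numbers suffice for the generator degrees, since
   S/I lives in nonnegative degrees. *)
Record free_complex := FreeComplex {
  grank : nat -> nat;
  gdeg : forall i, 'I_(grank i) -> nat;
  gdiff : forall i, 'M[S]_(grank i.+1, grank i);
  gaug : 'cV[S]_(grank 0) }.

Record minimal_resolution (I : set S) (F : free_complex) : Prop := {
  aug_homog : forall k, gaug F k 0 \is (gdeg (i := 0) k).-homog;
  diff_homog : forall i k l,
    homog_shift (gdeg (i := i.+1) k) (gdeg (i := i) l) (gdiff F i k l);
  aug_surj : forall p : S,
    exists u : 'rV_(grank F 0), I (p - (u *m gaug F) 0 0);
  aug_exact : forall u : 'rV_(grank F 0),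
    I ((u *m gaug F) 0 0) <->
    exists w : 'rV_(grank F 1), u = w *m gdiff F 0;
  diff_exact : forall i (u : 'rV_(grank F i.+1)),
    u *m gdiff F i = 0 <->
    exists w : 'rV_(grank F i.+2), u = w *m gdiff F i.+1;
  (* the image of F_(i+1) is contained in (x_1, ..., x_n) F_i *)
  diff_minimal : forall i k l, (gdiff F i k l)@_0%MM = 0 }.

(* The graded Betti number beta_(i, j) of S/I, for a homogeneous ideal I; the
   set below is a singleton, by existence and uniqueness up to isomorphism of
   minimal graded free resolutions, so that the default value 0 is never
   used. *)
Definition betti (I : set S) (i j : nat) : nat :=
  xget 0%N [set b | exists F, minimal_resolution I F /\
                              b = #|[pred k : 'I_(grank F i) | gdeg k == j]|].

Definition reg_values (I : set S) : set int :=
  [set r | exists i j, betti I i j <> 0%N /\ r = j%:Z - i%:Z].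

(* The regularity of S/I, i.e. the maximum of [reg_values I]; this maximum
   exists when I is a proper homogeneous ideal. *)
Definition reg_quotient (I : set S) : int :=
  xget 0 [set r | reg_values I r /\ forall s, reg_values I s -> s <= r].

Definition reg_ideal (I : set S) : int := reg_quotient I + 1.

End Regularity.

Section Graph.
Variables (V : finType) (e : rel V).

Definition edges : {set {set V}} :=
  [set A : {set V} | [exists x, exists y, e x y && (A == [set x; y]%SET)]]%SET.

Definition bipartite : bool :=
  [exists c : {ffun V -> bool}, forall x, forall y, e x y ==> (c x != c y)].

Variable K : fieldType.

(* The vertex v corresponds to the variable of index [enum_rank v] and the k-th
   variable of K[E_G] to the edge [enum_val k]. *)
Definition xvar (v : V) : {mpoly K[#|V|]} := 'X_(enum_rank v).

Definition edge_image (k : 'I_#|edges|) : {mpoly K[#|V|]} :=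
  \prod_(v in enum_val k) xvar v.

Definition theta (p : {mpoly K[#|edges|]}) : {mpoly K[#|V|]} :=
  p \mPo [tuple edge_image k | k < #|edges|].

Definition square_diff_ideal : set {mpoly K[#|V|]} :=
  [set p | exists c : V -> V -> {mpoly K[#|V|]},
     p = \sum_(i : V) \sum_(j : V) c i j * (xvar i ^+ 2 - xvar j ^+ 2)].

Definition IX : set {mpoly K[#|edges|]} := theta @^-1` square_diff_ideal.

End Graph.

Arguments IX {V} e K _.

(* Main.v *)
(* Let r be |V| - b_0(G), plus 1 if G is not bipartite, let S = K[E_G],
   I = I(X_G), and let t be the variable of an edge. Then t is a nonzerodivisor
   on S/I, because every vertex variable is one modulo the ideal of the
   x_i^2 - x_j^2. Moreover S/(I, t) vanishes in degrees >= r: a difference of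
   monomials of equal degree lies in I as soon as both monomials have the same
   degree parity at every vertex, and r + 1 distinct edges contain a nonempty
   even subset C meeting every vertex evenly, which allows the edges of C other
   than t in a monomial to be replaced by powers of t.
   For a minimal resolution F of S/I this says that F/tF has no homology in
   degree j of F_i/tF_i when j >= i + r. Each further variable z is regular on
   F modulo the previous ones, and the long exact sequence of multiplication by
   z preserves this vanishing. Modulo all variables the differential is zero by
   minimality, so F_i has no generator of degree >= i + r. *)

Require Import Defs.
From HB Require Import structures.
From mathcomp Require Import mpoly boolp classical_sets.
From mathcomp Require Import all_boot all_order all_algebra zify.
From mathcomp Require ssrcomplements.

Set Implicit Arguments.
Unset Strict Implicit.
Unset Printing Implicit Defensive.

Import Order.TTheory GRing.Theory Num.Theory.
Local Open Scope ring_scope.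

(** * Ideals generated by variables, and graded components of shifts of the ring *)

Section GradedPieces.
Variables (K : fieldType) (n : nat).
Local Notation S := {mpoly K[n]}.

Lemma eq_mcoeffM (p q p' q' : S) (m : 'X_{1..n}) :
  (forall m1 m2, m = (m1 + m2)%MM -> p@_m1 * q@_m2 = p'@_m1 * q'@_m2) ->
  (p * q)@_m = (p' * q')@_m.
Proof. by move=> h; rewrite !mcoeffM; apply: eq_bigr => k /eqP/h. Qed.

Lemma mcoeffM_eq0 (p q : S) (m : 'X_{1..n}) :
  (forall m1 m2, m = (m1 + m2)%MM -> p@_m1 * q@_m2 = 0) -> (p * q)@_m = 0.
Proof.
move=> h; rewrite -[RHS](mcoeff0 K m) -[0 in RHS](mul0r q).
by apply: eq_mcoeffM => m1 m2 /h ->; rewrite mcoeff0 mul0r.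
Qed.

(* [p] lies in the ideal generated by the variables with index in [s]. *)
Definition in_vars (s : seq 'I_n) (p : S) : Prop :=
  forall m : 'X_{1..n}, (forall i, i \in s -> m i = 0%N) -> p@_m = 0.

Lemma in_vars_nil (p : S) : in_vars [::] p <-> p = 0.
Proof.
split=> [h|-> m _]; last by rewrite mcoeff0.
by apply/mpolyP => m; rewrite mcoeff0 h.
Qed.

Lemma in_vars0 s : in_vars s 0.
Proof. by move=> m _; rewrite mcoeff0. Qed.

Lemma in_varsD s p q : in_vars s p -> in_vars s q -> in_vars s (p + q).
Proof. by move=> hp hq m hm; rewrite mcoeffD hp // hq // addr0. Qed.

Lemma in_varsN s p : in_vars s p -> in_vars s (- p).
Proof. by move=> hp m hm; rewrite mcoeffN hp // oppr0. Qed.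

Lemma in_varsM s p q : in_vars s p -> in_vars s (p * q).
Proof.
move=> hp m hm; apply: mcoeffM_eq0 => m1 m2 mE.
rewrite hp ?mul0r // => i /hm.
by rewrite mE mnmDE => /eqP; rewrite addn_eq0 => /andP[/eqP].
Qed.

Lemma in_vars_subset s1 s2 p :
  {subset s1 <= s2} -> in_vars s1 p -> in_vars s2 p.
Proof. by move=> s12 hp m hm; apply: hp => i /s12/hm. Qed.

Lemma mcoeffXM (p : S) i (m : 'X_{1..n}) :
  ('X_i * p)@_m = if m i == 0%N then 0 else p@_(m - U_(i))%MM.
Proof.
have [mi0|mi] := eqVneq (m i) 0%N; last first.
  by rewrite -(mcoeffMX p U_(i)) addmC submK ?lep1mP // mulrC.
apply: mcoeffM_eq0 => m1 m2 mE.
rewrite mcoeffX; case: eqP; last by rewrite mul0r.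
by move=> kE; move: mi0; rewrite mE mnmDE -kE mnm1E eqxx.
Qed.

Lemma in_varsX (k : 'I_n) s : in_vars (k :: s) 'X_k.
Proof.
move=> m hm; rewrite mcoeffX; case: eqP => // mE.
by have := hm k; rewrite -mE mnm1E eqxx inE eqxx => /(_ isT).
Qed.

(** Multiplication by ['X_k] changes exponents only at [k], outside [s], so ['X_k] is regular modulo
    the variables in [s]. *)
Lemma in_vars_mulXl (k : 'I_n) s (p : S) :
  k \notin s -> in_vars s ('X_k * p) -> in_vars s p.
Proof.
move=> ks hp m hm; have := hp (U_(k) + m)%MM.
rewrite mulrC mcoeffMX; apply=> i si.
rewrite mnmDE hm // mnm1E; case: eqP => // kE.
by move: ks; rewrite kE si.
Qed.

(** The quotient collects the terms of [p] divisible by ['X_k]; every other term involves a variable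
    in [s]. *)
Lemma in_vars_div (k : 'I_n) s (p : S) :
  in_vars (k :: s) p -> exists v, in_vars s (p - 'X_k * v).
Proof.
move=> hp.
have [v vE] : exists v : S, forall m : 'X_{1..n}, v@_m = p@_(m + U_(k))%MM.
  elim/mpolyind: p {hp} => [|c m p _ _ [v vE]].
    by exists 0 => m; rewrite !mcoeff0.
  exists ((if m k == 0%N then 0 else c *: 'X_[m - U_(k)]) + v) => m'.
  rewrite !mcoeffD vE; congr (_ + _).
  rewrite mcoeffZ mcoeffX.
  have [mk|mk] := eqVneq (m k) 0%N.
    rewrite mcoeff0; case: eqP; last by rewrite mulr0.
    by move=> mE; move: mk; rewrite mE mnmDE mnm1E eqxx addn1.
  rewrite mcoeffZ mcoeffX; congr (_ * (nat_of_bool _)%:R).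
  have mE : (U_(k) <= m)%MM by rewrite lep1mP.
  by apply/eqP/eqP => [<-|->]; rewrite ?submK // addmK.
exists v => m hm; rewrite mcoeffB mcoeffXM.
have [mk|mk] := eqVneq (m k) 0%N.
  by rewrite subr0 hp // => i; rewrite inE => /orP[/eqP->|/hm].
by rewrite vE submK ?subrr // lep1mP.
Qed.

(* The projection onto the component of degree [a] of the shift S(-b). *)
Definition shift_part (a b : nat) (p : S) : S :=
  if (b <= a)%N then pihomog mdeg (a - b) p else 0.

Lemma mcoeff_shift_part a b p m :
  (shift_part a b p)@_m = if (mdeg m + b)%N == a then p@_m else 0.
Proof.
rewrite /shift_part; case: leqP => [ba|ab]; last first.
  by rewrite mcoeff0; case: eqP => //; lia.
rewrite pihomogE linear_sum /=.
have -> : ((mdeg m + b)%N == a) = (mdeg m == a - b)%N.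
  by apply/eqP/eqP; lia.
under eq_bigr do rewrite mcoeffZ mcoeffX.
rewrite big_mkcond /=.
have [md|md] := boolP (mdeg m == a - b)%N; last first.
  rewrite big1 // => k _; case: ifP => // kd.
  by case: eqP => [km|]; rewrite ?mulr0 // -km kd in md *.
have [pm|pm] := boolP (m \in msupp p); last first.
  rewrite (memN_msupp_eq0 pm) big_seq_cond big1 // => k /andP[kp _].
  case: ifP => // _; case: eqP => [km|]; last by rewrite mulr0.
  by rewrite -km kp in pm.
rewrite (bigD1_seq m) //= md eqxx mulr1 big1 ?addr0 // => k /negPf->.
by rewrite mulr0 if_same.
Qed.

Lemma shift_partB a b : {morph shift_part a b : p q / p - q}.
Proof.
move=> p q; apply/mpolyP=> m; rewrite mcoeffB !mcoeff_shift_part mcoeffB.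
by case: ifP => // _; rewrite subr0.
Qed.

Lemma shift_part_sum a b (T : finType) (f : T -> S) :
  shift_part a b (\sum_t f t) = \sum_t shift_part a b (f t).
Proof.
apply/mpolyP=> m; rewrite mcoeff_shift_part !linear_sum /=.
under [in RHS]eq_bigr do rewrite mcoeff_shift_part.
by case: ifP => // _; rewrite big1.
Qed.

Lemma shift_part_id a b p : homog_shift a b p -> shift_part a b p = p.
Proof.
rewrite /homog_shift /shift_part; case: leqP => _; last by move/eqP->.
exact: pihomog_dE.
Qed.

Lemma shift_part_in_vars a b s p : in_vars s p -> in_vars s (shift_part a b p).
Proof. by move=> hp m hm; rewrite mcoeff_shift_part hp // if_same. Qed.

(** The hypothesis makes [q] homogeneous of degree (a' - b') - (a - b), stated without subtraction;
    this covers both the entries of the differentials and the variables. *)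
Lemma shift_partM a b a' b' p q :
  (forall m, (mdeg m + b' + a)%N != (a' + b)%N -> q@_m = 0) ->
  shift_part a' b' (p * q) = shift_part a b p * q.
Proof.
move=> hq; apply/mpolyP=> m; rewrite mcoeff_shift_part.
have [md|md] := eqVneq (mdeg m + b')%N a'.
  apply: eq_mcoeffM => m1 m2 mE; rewrite mcoeff_shift_part.
  have [m2d|/hq ->] := eqVneq (mdeg m2 + b' + a)%N (a' + b)%N;
    last by rewrite !mulr0.
  by case: eqP => // -[]; rewrite mE mdegD in md; lia.
symmetry; apply: mcoeffM_eq0 => m1 m2 mE; rewrite mcoeff_shift_part.
have [m2d|/hq ->] := eqVneq (mdeg m2 + b' + a)%N (a' + b)%N;
  last by rewrite !mulr0.
case: eqP => [|_]; last by rewrite mul0r.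
by rewrite mE mdegD in md; move/eqP: md; lia.
Qed.

Lemma shift_partM_homog a b b' p q : homog_shift b b' q ->
  shift_part a b' (p * q) = shift_part a b p * q.
Proof.
move=> hq; apply: shift_partM => m.
rewrite -(shift_part_id hq) mcoeff_shift_part => /eqP md.
by case: eqP => // mE; case: md; lia.
Qed.

Lemma shift_partXM a b i p :
  shift_part a.+1 b ('X_i * p) = 'X_i * shift_part a b p.
Proof.
rewrite mulrC [RHS]mulrC; apply: shift_partM => m md.
by rewrite mcoeffX; case: eqP => // mE; move: md; rewrite -mE mdeg1; case: eqP; lia.
Qed.

End GradedPieces.

(** * Homology of a resolution modulo a set of variables *)

Section RelativeCycles.
Variables (K : fieldType) (n : nat) (I : set {mpoly K[n]}).
Variables (F : free_complex K n) (Fres : minimal_resolution I F).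
Local Notation S := {mpoly K[n]}.

Definition row_in_vars (s : seq 'I_n) m (u : 'rV[S]_m) : Prop :=
  forall l, in_vars s (u 0 l).

Lemma row_in_vars_nil m (u : 'rV[S]_m) : row_in_vars [::] u <-> u = 0.
Proof.
split=> [h|-> l]; last by rewrite mxE; exact: in_vars0.
by apply/rowP => l; rewrite mxE; exact/in_vars_nil.
Qed.

Lemma row_in_varsD s m (u v : 'rV[S]_m) :
  row_in_vars s u -> row_in_vars s v -> row_in_vars s (u + v).
Proof. by move=> hu hv l; rewrite mxE; exact: in_varsD. Qed.

Lemma row_in_varsN s m (u : 'rV[S]_m) : row_in_vars s u -> row_in_vars s (- u).
Proof. by move=> hu l; rewrite mxE; exact: in_varsN. Qed.

Lemma row_in_varsM s m p (u : 'rV[S]_m) (D : 'M_(m, p)) :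
  row_in_vars s u -> row_in_vars s (u *m D).
Proof.
move=> hu l; rewrite mxE; elim/big_ind: _ => [|p1 p2|k _].
- exact: in_vars0.
- exact: in_varsD.
- exact: in_varsM.
Qed.

Lemma row_in_varsZ k s m (u : 'rV[S]_m) : row_in_vars (k :: s) ('X_k *: u).
Proof. by move=> l; rewrite mxE; apply: in_varsM; exact: in_varsX. Qed.

Lemma row_in_vars_cons k s m (u : 'rV[S]_m) :
  row_in_vars s u -> row_in_vars (k :: s) u.
Proof. by move=> hu l; apply: in_vars_subset (hu l) => i; rewrite inE orbC => ->. Qed.

Lemma row_in_vars_div k s m (u : 'rV[S]_m) :
  row_in_vars (k :: s) u -> exists v, row_in_vars s (u - 'X_k *: v).
Proof.
move=> hu; have /choice[v hv] l := in_vars_div (hu l).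
by exists (\row_l v l) => l; rewrite !mxE.
Qed.

Lemma row_in_vars_mulXl k s m (u : 'rV[S]_m) :
  k \notin s -> row_in_vars s ('X_k *: u) -> row_in_vars s u.
Proof.
by move=> ks hu l; apply: (in_vars_mulXl ks); have := hu l; rewrite mxE.
Qed.

(** Below, [row_part j u = u] expresses that [u] is homogeneous of degree [j] in F_i. *)
Definition row_part i j (u : 'rV[S]_(grank F i)) : 'rV[S]_(grank F i) :=
  \row_l shift_part j (gdeg l) (u 0 l).

Lemma row_partB i j : {morph @row_part i j : u v / u - v}.
Proof. by move=> u v; apply/rowP=> l; rewrite !mxE shift_partB. Qed.

Lemma row_partZ i j k (u : 'rV_(grank F i)) :
  row_part j.+1 ('X_k *: u) = 'X_k *: row_part j u.
Proof. by apply/rowP=> l; rewrite !mxE shift_partXM. Qed.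

Lemma row_part_diff i j (u : 'rV_(grank F i.+1)) :
  row_part j (u *m gdiff F i) = row_part j u *m gdiff F i.
Proof.
apply/rowP=> l; rewrite !mxE shift_part_sum; apply: eq_bigr => k _.
by rewrite mxE (shift_partM_homog _ _ (diff_homog Fres k l)).
Qed.

Lemma row_part_id i j (u : 'rV_(grank F i)) :
  row_part j (row_part j u) = row_part j u.
Proof.
apply/rowP => l; apply/mpolyP=> m; rewrite !mxE !mcoeff_shift_part.
by case: ifP => // ->.
Qed.

Lemma row_part_in_vars s i j (u : 'rV_(grank F i)) :
  row_in_vars s u -> row_in_vars s (row_part j u).
Proof. by move=> hu l; rewrite mxE; exact: shift_part_in_vars. Qed.

Lemma aug_row_part_homog j (u : 'rV_(grank F 0)) :
  row_part j u = u -> (u *m gaug F) 0 0 \is j.-homog.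
Proof.
move=> uj; suff <- : shift_part j 0 ((u *m gaug F) 0 0) = (u *m gaug F) 0 0.
  by rewrite /shift_part subn0; exact: pihomogP.
rewrite mxE shift_part_sum; apply: eq_bigr => k _.
rewrite (@shift_partM_homog _ _ _ (gdeg k)); first by rewrite -[in RHS]uj mxE.
by rewrite /homog_shift leq0n subn0; apply: aug_homog Fres _.
Qed.

Lemma diff_diff i (u : 'rV_(grank F i.+2)) :
  u *m gdiff F i.+1 *m gdiff F i = 0.
Proof. by apply/(diff_exact Fres); exists u. Qed.

(** Classes in F_i/(s)F_i are represented in F_i. The augmentation is left out, so all of F_0
    consists of cycles and H_0 is S/(I, s). *)
Definition rel_cycle s i : 'rV[S]_(grank F i) -> Prop :=
  match i with
  | 0 => fun=> True
  | i'.+1 => fun u => row_in_vars s (u *m gdiff F i')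
  end.

Definition rel_boundary s i (u : 'rV[S]_(grank F i)) : Prop :=
  exists w : 'rV_(grank F i.+1), row_in_vars s (u - w *m gdiff F i).

(* Vanishing of H_i(F/(s)F) in the degrees j >= i + r. *)
Definition rel_exact r s : Prop := forall i j (u : 'rV_(grank F i)),
  (i + r <= j)%N -> row_part j u = u -> rel_cycle s u -> rel_boundary s u.

Lemma rel_boundary_part s i j (u : 'rV_(grank F i)) :
  row_part j u = u -> rel_boundary s u ->
  exists2 w : 'rV_(grank F i.+1),
    row_part j w = w & row_in_vars s (u - w *m gdiff F i).
Proof.
move=> uj [w hw]; exists (row_part j w); last first.
  by rewrite -row_part_diff -{1}uj -row_partB; exact: row_part_in_vars.
exact: row_part_id.
Qed.

(** This is the connecting homomorphism, from the class of [u] to that of [v]. Since the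
    differential squares to zero, ['X_k] times the boundary of [v] lies in (s), and ['X_k] is
    regular modulo [s]. *)
Lemma rel_cycle_div k s i j (u : 'rV_(grank F i.+1)) :
  k \notin s -> row_part j.+1 u = u -> rel_cycle (k :: s) u ->
  exists v, [/\ row_part j v = v, rel_cycle s v &
                row_in_vars s (u *m gdiff F i - 'X_k *: v)].
Proof.
move=> ks uj /row_in_vars_div[v hv]; exists (row_part j v).
have hvj : row_in_vars s (u *m gdiff F i - 'X_k *: row_part j v).
  by rewrite -row_partZ -{1}uj -row_part_diff -row_partB; exact: row_part_in_vars.
split=> //; first exact: row_part_id.
case: i => // i in u uj v hv hvj *.
have /row_in_varsN := row_in_varsM (gdiff F i) hvj.
rewrite mulmxBl diff_diff sub0r opprK -scalemxAl.
exact: row_in_vars_mulXl.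
Qed.

(* This is the long exact sequence of 0 -> F/(s)F -> F/(s)F -> F/(k :: s)F -> 0,
   where the first map is multiplication by the k-th variable. *)
Lemma rel_exact_cons r s k : k \notin s -> rel_exact r s -> rel_exact r (k :: s).
Proof.
move=> ks ex [|i] j u ij uj uc.
  have [w hw] := ex 0%N j u ij uj Logic.I.
  by exists w; exact: row_in_vars_cons.
case: j ij uj => // j ij uj.
have [v [vj vc huv]] := rel_cycle_div ks uj uc.
(* Both indices drop by one from [u] to [v], so [v] is still in the range of vanishing. Then
   [u - 'X_k *: w] is a cycle modulo [s] in the class of [u] modulo [k :: s]. *)
have [w wj hw] := rel_boundary_part vj (ex i j v ij vj vc).
have u'j : row_part j.+1 (u - 'X_k *: w) = u - 'X_k *: w.
  by rewrite row_partB row_partZ uj wj.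
have [|w' hw'] := ex i.+1 j.+1 _ ij u'j.
  rewrite /= mulmxBl -scalemxAl -[X in X - _](subrK ('X_k *: v)) -addrA -scalerBr.
  apply: row_in_varsD => // l; rewrite mxE mulrC; apply: in_varsM; exact: hw.
exists w'; rewrite -(subrK ('X_k *: w) u) addrAC.
by apply: row_in_varsD; [exact: row_in_vars_cons|exact: row_in_varsZ].
Qed.

(** H_0 is S/(I, ['X_x]), which vanishes in degrees >= r by [fin]. H_1 is the kernel of ['X_x] on
    S/I, zero by [nzd]; higher homology vanishes because F is exact there and ['X_x] cancels in free
    modules. *)
Lemma rel_exact_single r x
    (ID : forall p q, I p -> I q -> I (p + q))
    (IM : forall p q, I p -> I (q * p))
    (nzd : forall p, I ('X_x * p) -> I p)
    (fin : forall j p, (r <= j)%N -> p \is j.-homog ->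
             exists q, I (p - 'X_x * q)) :
  rel_exact r [:: x].
Proof.
move=> [|i] j u ij uj uc.
  have [q Iq] := fin j _ ij (aug_row_part_homog uj).
  have [w Iw] := aug_surj Fres q.
  have /(aug_exact Fres)[w' hw'] : I (((u - 'X_x *: w) *m gaug F) 0 0).
    rewrite mulmxBl -scalemxAl; set a := u *m _ in Iq *; set b := w *m _ in Iw *.
    clearbody a b; rewrite !mxE; have := ID _ _ Iq (IM _ 'X_x Iw).
    by rewrite mulrBr addrA subrK.
  by exists w'; rewrite -hw' opprB addrCA subrr addr0; exact: row_in_varsZ.
case: j ij uj => // j ij uj.
have [v [vj vc /row_in_vars_nil/eqP]] := rel_cycle_div (isT : x \notin [::]) uj uc.
rewrite subr_eq0 => /eqP duE.
have Xv0 p (D : 'M_(_, p)) :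
    u *m gdiff F i *m D = 0 -> v *m D = 0.
  rewrite duE -scalemxAl => /row_in_vars_nil h.
  by apply/row_in_vars_nil; apply: row_in_vars_mulXl h.
have [w hw] : exists w, v = w *m gdiff F i.
  case: i => [|i] in u ij uj uc v vj vc duE Xv0 *.
    apply/(aug_exact Fres)/nzd.
    suff -> : 'X_x * (v *m gaug F) 0 0 = (u *m gdiff F 0 *m gaug F) 0 0.
      by apply/(aug_exact Fres); exists u.
    by rewrite duE -scalemxAl [RHS]mxE.
  by apply/(diff_exact Fres)/Xv0; exact: diff_diff.
have /(diff_exact Fres)[w' hw'] : (u - 'X_x *: w) *m gdiff F i = 0.
  by rewrite mulmxBl -scalemxAl -hw duE subrr.
by exists w'; rewrite -hw' opprB addrCA subrr addr0; exact: row_in_varsZ.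
Qed.

(** Modulo all variables a basis vector of F_i is a cycle, by minimality, but not a boundary, so its
    degree lies outside the range of vanishing. *)
Lemma gdeg_lt r x i (k : 'I_(grank F i))
    (ID : forall p q, I p -> I q -> I (p + q))
    (IM : forall p q, I p -> I (q * p))
    (nzd : forall p, I ('X_x * p) -> I p)
    (fin : forall j p, (r <= j)%N -> p \is j.-homog ->
             exists q, I (p - 'X_x * q)) :
  (gdeg k < i + r)%N.
Proof.
(* Variables are adjoined to [x] one at a time; one already present is skipped, as it would not be
   regular. *)
have ex (s : seq 'I_n) : exists2 s', {subset s <= s'} & rel_exact r s'.
  elim: s => [|y s [s' ss' ex]].
    by exists [:: x] => //; exact: rel_exact_single.
  have [ys'|ys'] := boolP (y \in s').
    by exists s' => // z; rewrite inE => /predU1P[->|/ss'].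
  exists (y :: s'); last exact: rel_exact_cons.
  by move=> z; rewrite !inE => /orP[->|/ss' ->]; rewrite ?orbT.
have [s all_s {}ex] := ex (enum 'I_n); rewrite ltnNge; apply/negP=> kd.
have in_s p : in_vars s p <-> p@_0%MM = 0.
  split=> [|p0 m hm]; first by apply=> y _; rewrite mnm0E.
  suff -> : m = 0%MM by [].
  by apply/mnmP => y; rewrite mnm0E hm // all_s ?mem_enum.
pose u : 'rV[S]_(grank F i) := delta_mx 0 k.
have uk : row_part (gdeg k) u = u.
  apply/rowP=> l; apply/mpolyP=> m; rewrite !mxE mcoeff_shift_part eqxx /=.
  case: eqP => // md; have [lk|_] := eqVneq l k; last by rewrite mcoeff0.
  by rewrite mcoeff1; case: eqP md => // ->; rewrite mdeg0 lk.
have min_s i' (w : 'rV_(grank F i'.+1)) : row_in_vars s (w *m gdiff F i').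
  move=> l; apply/in_s; rewrite mxE raddf_sum /= big1 // => k' _.
  by rewrite rmorphM /= (diff_minimal Fres) mulr0.
have [|w /(_ k)] := ex i _ u kd uk.
  by case: i => [//|i] in k kd u uk *; exact: min_s.
move=> h; have := in_varsD h (min_s _ w k).
by rewrite !mxE subrK !eqxx => /in_s; rewrite mcoeff1 eqxx => /eqP; rewrite oner_eq0.
Qed.

End RelativeCycles.

(** * Linear maps given by their values on monomials *)

Section LinearExtension.
Variables (K : fieldType) (n : nat) (W : lmodType K) (h : 'X_{1..n} -> W).
Local Notation S := {mpoly K[n]}.

Definition lin_ext (p : S) : W := \sum_(m <- msupp p) p@_m *: h m.

(** A common size bound gives several polynomials the same index set, so linearity can be checked
    termwise. *)
Lemma lin_extE k p :
  (msize p <= k)%N -> lin_ext p = \sum_(m : 'X_{1..n < k}) p@_m *: h m.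
Proof.
move=> pk; rewrite /lin_ext (ssrcomplements.big_mksub 'X_{1..n < k}) //=; first last.
- by move=> m /msize_mdeg_lt /leq_trans /(_ pk) ->.
- by rewrite msupp_uniq.
by rewrite big_rmcond //= => m /memN_msupp_eq0 ->; rewrite scale0r.
Qed.

Lemma lin_ext_is_linear : linear lin_ext.
Proof.
move=> c p q; pose k := maxn (msize (c *: p + q)) (maxn (msize p) (msize q)).
rewrite !(@lin_extE k) ?leq_max ?leqnn ?orbT // scaler_sumr -big_split /=.
by apply: eq_bigr => m _; rewrite mcoeffD mcoeffZ scalerDl scalerA.
Qed.

HB.instance Definition _ :=
  GRing.isLinear.Build K S W *:%R lin_ext lin_ext_is_linear.

Lemma lin_extX m : lin_ext 'X_[m] = h m.
Proof. by rewrite /lin_ext msuppX big_seq1 mcoeffX eqxx scale1r. Qed.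

End LinearExtension.

(** * Normal forms modulo the ideal of square differences *)

Section SquareDifferences.
Variables (V : finType) (K : fieldType).
Local Notation T := {mpoly K[#|V|]}.
Local Notation J := (@square_diff_ideal V K).
Local Notation x := (xvar K).

Lemma square_diff0 : J 0.
Proof.
exists (fun _ _ => 0); rewrite !big1 // => i _.
by rewrite big1 // => j _; rewrite mul0r.
Qed.

Lemma square_diffD p q : J p -> J q -> J (p + q).
Proof.
move=> [c ->] [d ->]; exists (fun i j => c i j + d i j).
rewrite -big_split; apply: eq_bigr => i _; rewrite -big_split.
by apply: eq_bigr => j _; rewrite mulrDl.
Qed.

Lemma square_diffM p q : J p -> J (q * p).
Proof.
move=> [c ->]; exists (fun i j => q * c i j).
rewrite mulr_sumr; apply: eq_bigr => i _; rewrite mulr_sumr.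
by apply: eq_bigr => j _; rewrite mulrA.
Qed.

Lemma square_diff_gen i j : J (x i ^+ 2 - x j ^+ 2).
Proof.
exists (fun i' j' => ((i' == i) && (j' == j))%:R).
rewrite (bigD1 i) //= (bigD1 j) //= !eqxx mul1r !big1 ?addr0 //.
  move=> i' /negPf ii'; rewrite big1 // => j' _; by rewrite ii' mul0r.
by move=> j' /negPf ->; rewrite mul0r.
Qed.

Lemma square_diff_congrM p p' q q' :
  J (p - p') -> J (q - q') -> J (p * q - p' * q').
Proof.
move=> /(square_diffM q) hp /(square_diffM p') hq.
have := square_diffD hp hq; congr J.
by rewrite !mulrBr addrA mulrC (mulrC q p') subrK.
Qed.

Lemma square_diff_congr_prod (f g : V -> T) :
  (forall v, J (f v - g v)) -> J (\prod_v f v - \prod_v g v).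
Proof.
move=> h; elim/big_ind2: _ => [|p p' q q'|v _] //.
  by rewrite subrr; exact: square_diff0.
exact: square_diff_congrM.
Qed.

Lemma square_diff_congr_expr p q k : J (p - q) -> J (p ^+ k - q ^+ k).
Proof.
move=> h; elim: k => [|k IH]; first by rewrite subrr; exact: square_diff0.
by rewrite !exprS; exact: square_diff_congrM.
Qed.

(* The normal form of a monomial modulo J: all squares are moved to [a]. *)
Definition square_nf (a : V) (f : V -> nat) : T :=
  \prod_v (x v ^+ odd (f v) * x a ^+ (f v)./2.*2).

Lemma square_nf_congr a f : J (\prod_v x v ^+ f v - square_nf a f).
Proof.
apply: square_diff_congr_prod => v.
rewrite -{1}(odd_double_half (f v)) exprD -mulrBr; apply: square_diffM.
rewrite -mul2n !exprM; apply: square_diff_congr_expr; exact: square_diff_gen.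
Qed.

(** The normal form is a squarefree monomial fixed by the parities, times a power of [x a] then
    fixed by the total degree. *)
Lemma eq_square_nf a f g :
    (forall v, odd (f v) = odd (g v)) -> (\sum_v f v = \sum_v g v)%N ->
  square_nf a f = square_nf a g.
Proof.
move=> fg sfg; rewrite /square_nf !big_split !prodrXr /=; congr (_ * _ ^+ _).
  by apply: eq_bigr => v _; rewrite fg.
move: sfg; under eq_bigr do rewrite -[f _]odd_double_half.
under [in RHS]eq_bigr do rewrite -[g _]odd_double_half.
rewrite !big_split /=; under eq_bigr do rewrite fg.
by move/addnI.
Qed.

Lemma square_nfS a f :
  square_nf a (fun v => (v == a) + f v)%N = x a * square_nf a f.
Proof.
rewrite /square_nf (bigD1 a) //= [in RHS](bigD1 a) //= mulrA; congr (_ * _).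
  by rewrite eqxx -!exprD !odd_double_half -exprS.
by apply: eq_bigr => v /negPf ->.
Qed.

Definition mnm_fun (m : 'X_{1..#|V|}) (v : V) : nat := m (enum_rank v).

Lemma mpolyX_xvar m : 'X_[m] = \prod_v x v ^+ mnm_fun m v.
Proof.
rewrite mpolyXE_id (reindex enum_rank) //=.
by exists enum_val => v _; rewrite ?enum_rankK ?enum_valK.
Qed.

(** The kernel of this linear map is exactly J, which turns membership in J into an equation in the
    domain T. *)
Definition square_nf_poly (a : V) : T -> T :=
  lin_ext (fun m => square_nf a (mnm_fun m)).

HB.instance Definition _ a := GRing.Linear.on (square_nf_poly a).

Lemma square_nf_polyE a m : square_nf_poly a 'X_[m] = square_nf a (mnm_fun m).
Proof. exact: lin_extX. Qed.

Lemma square_nf_poly_congr a p : J (p - square_nf_poly a p).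
Proof.
elim/mpolyind: p => [|c m p _ _ IH].
  by rewrite linear0 subrr; exact: square_diff0.
rewrite linearP opprD addrACA -scalerBr; apply: square_diffD => //.
rewrite -mul_mpolyC; apply: square_diffM.
rewrite /= square_nf_polyE {1}mpolyX_xvar; exact: square_nf_congr.
Qed.

Lemma sum_mnm_fun m : (\sum_v mnm_fun m v = mdeg m)%N.
Proof.
rewrite mdegE (reindex (@enum_rank V)) //=.
by exists enum_val => v _; rewrite ?enum_rankK ?enum_valK.
Qed.

(** The products of one monomial with x_i^2 and with x_j^2 agree in parities and degree, hence in
    normal form. *)
Lemma square_nf_poly_eq0 a p : J p -> square_nf_poly a p = 0.
Proof.
move=> [c ->]; rewrite linear_sum big1 //= => i _; rewrite linear_sum big1 //= => j _.
elim/mpolyind: (c i j) => [|d m q _ _ IH]; first by rewrite mul0r linear0.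
rewrite mulrDl linearD /= IH addr0 -scalerAl linearZ /= mulrBr linearB /=.
rewrite /xvar !mpolyXn -!mpolyXD !square_nf_polyE.
rewrite (@eq_square_nf _ _ (mnm_fun (m + U_(enum_rank j) *+ 2))) ?subrr ?scaler0 //.
  by move=> v; rewrite /mnm_fun ![(m + _)%MM _]mnmDE !mulmnE !oddD !oddM !andbF.
by rewrite !sum_mnm_fun ![mdeg (m + _)%MM]mdegD !mdegMn !mdeg1.
Qed.

Lemma square_nf_polyX a p : square_nf_poly a (x a * p) = x a * square_nf_poly a p.
Proof.
elim/mpolyind: p => [|c m p _ _ IH]; first by rewrite mulr0 linear0 mulr0.
rewrite mulrDr !linearD /= IH mulrDr -scalerAr !linearZ /= -scalerAr.
congr (_ *: _ + _); rewrite /xvar -mpolyXD !square_nf_polyE -square_nfS.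
congr square_nf; apply/funext => v.
by rewrite /mnm_fun mnmDE mnm1E (inj_eq enum_rank_inj) eq_sym.
Qed.

(** With the squares collected at [a] itself, the normal form commutes with multiplication by [x a],
    which cancels in T. *)
Lemma square_diff_nzd a p : J (x a * p) -> J p.
Proof.
move=> /(square_nf_poly_eq0 a); rewrite square_nf_polyX => /eqP.
rewrite mulf_eq0 {1}/xvar -msupp_eq0 msuppX /= => /eqP p0.
by have := square_nf_poly_congr a p; rewrite p0 subr0.
Qed.

Lemma square_diff_congr_mon (f g : V -> nat) :
    (forall v, odd (f v) = odd (g v)) -> (\sum_v f v = \sum_v g v)%N ->
  J (\prod_v x v ^+ f v - \prod_v x v ^+ g v).
Proof.
move=> fg sfg; have [a _|noV] := pickP (@predT V); last first.
  by rewrite !big_pred0 // subrr; exact: square_diff0.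
have Nf := square_nf_congr a f; have := square_diffM (- 1) (square_nf_congr a g).
rewrite mulN1r opprB (eq_square_nf a fg sfg) in Nf * => /(square_diffD Nf).
by rewrite addrA subrK.
Qed.

End SquareDifferences.

(** * Parities of vertex degrees in edge sets and edge monomials *)

Section ParityExchange.
Variables (V : finType) (e : rel V).
Hypotheses (e_sym : symmetric e) (e_irrefl : irreflexive e).
Local Notation n := #|edges e|.
Local Notation nonroots := [set v | ~~ roots e v]%SET.

Definition edge (k : 'I_n) : {set V} := enum_val k.

(** This is the exponent of the variable of [v] in the image of the monomial [a] under [theta]. *)
Definition incidence (a : 'X_{1..n}) (v : V) : nat :=
  (\sum_(k < n) a k * (v \in edge k))%N.

Lemma edgeP k : exists x y, e x y /\ edge k = [set x; y]%SET.
Proof.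
have := enum_valP k; rewrite inE => /existsP[x /existsP[y /andP[exy /eqP]]].
by exists x, y.
Qed.

Lemma sum_edge (P : pred V) x y : e x y ->
  (\sum_(v | P v) (v \in [set x; y]%SET) = P x + P y)%N.
Proof.
move=> exy; have xy : x != y by apply: contraTneq exy => ->; rewrite e_irrefl.
rewrite big_mkcond (bigD1 x) //= (bigD1 y) 1?eq_sym //= big1 => [|v].
  by rewrite !inE !eqxx orbT addn0; case: (P x) (P y) => -[].
by rewrite !inE => /andP[/negPf-> /negPf->]; rewrite if_same.
Qed.

Lemma sum_incidence a : (\sum_v incidence a v = mdeg a * 2)%N.
Proof.
rewrite exchange_big /= mdegE big_distrl; apply: eq_bigr => k _.
rewrite -big_distrr /=; have [x [y [exy ->]]] := edgeP k.
by rewrite (sum_edge predT exy).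
Qed.

Lemma incidenceD a b v : incidence (a + b) v = (incidence a v + incidence b v)%N.
Proof.
by rewrite /incidence -big_split; apply: eq_bigr => k _; rewrite mnmDE mulnDl.
Qed.

Lemma incidenceMn a d v : incidence (a *+ d) v = (incidence a v * d)%N.
Proof.
rewrite /incidence big_distrl; apply: eq_bigr => k _ /=.
by rewrite mulmnE mulnAC.
Qed.

Lemma incidence1 k v : incidence U_(k) v = (v \in edge k).
Proof.
rewrite /incidence (bigD1 k) //= big1 => [|k' /negPf kk'].
  by rewrite mnm1E eqxx mul1n addn0.
by rewrite mnm1E eq_sym kk'.
Qed.

Lemma even_sum (T : finType) (P : pred T) (f : T -> nat) :
  (forall t, P t -> ~~ odd (f t)) -> ~~ odd (\sum_(t | P t) f t)%N.
Proof.
move=> h; elim/big_ind: _ => // a b /negPf ha /negPf hb.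
by rewrite oddD ha hb.
Qed.

Lemma odd_sum_symdiff (T : finType) (A B : {set T}) (f : T -> nat) :
  odd (\sum_(t in ((A :\: B) :|: (B :\: A))%SET) f t) =
  odd (\sum_(t in A) f t) (+) odd (\sum_(t in B) f t).
Proof.
rewrite (eq_bigl [predU A :\: B & B :\: A])%SET => [|t]; last by rewrite !inE.
rewrite bigU /=; last first.
  by rewrite -setI_eq0; apply/eqP/setP => t; rewrite !inE; do !case: (_ \in _).
rewrite [in X in _ = odd X (+) _](big_setID B) /=.
rewrite [in X in _ = _ (+) odd X](big_setID A) /= (setIC B A) !oddD.
by rewrite addbACA addbb.
Qed.

(** Counting replaces linear algebra over F_2: an additive invariant vanishes on the symmetric
    difference of the two subsets. *)
Lemma pigeonhole_subset (T : finType) (W : finType) (J : {set T}) (D : {set W})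
    (f : {set T} -> W) :
    (forall A, f A \in D) -> (#|D| < 2 ^ #|J|)%N ->
  exists A B : {set T}, [/\ A \subset J, B \subset J, A != B & f A = f B].
Proof.
move=> fD DJ; have /dinjectivePn[A AJ [B]] : ~~ dinjectiveb f (powerset J).
  apply: contraL DJ => /dinjectiveP inj; rewrite -leqNgt -card_powerset.
  rewrite -(card_in_imset inj).
  apply/subset_leq_card/fintype.subsetP => _ /imsetP[A _ ->].
  exact: fD.
rewrite !inE in AJ * => /andP[BA BJ] fAB.
by exists A, B; rewrite eq_sym.
Qed.

(* Over F_2 the boundary of an edge set, together with the parity of its size,
   takes values in a space of dimension #|nonroots| + ~~ bipartite: the
   boundary at the root of a component is the sum of those at its other
   vertices, and for a 2-colouring the size is the sum of the boundary over a
   colour class. *)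
Lemma even_dependency (J : {set 'I_n}) :
    (#|nonroots| + ~~ bipartite e < #|J|)%N ->
  exists C : {set 'I_n}, [/\ C \subset J, C != finset.set0, ~~ odd #|C| &
    forall v, ~~ odd (\sum_(k in C) (v \in edge k))].
Proof.
move=> rJ.
pose f (C : {set 'I_n}) :=
  ([set v | ~~ roots e v & odd (\sum_(k in C) (v \in edge k))]%SET,
   ~~ bipartite e && odd #|C|).
(* For bipartite graphs the second component is always false, so [D] has 2^(#|nonroots| + ~~
   bipartite e) elements. *)
pose D := finset.setX (powerset nonroots)
  [set b | b ==> ~~ bipartite e]%SET.
have [||A [B [AJ BJ AB fAB]]] := @pigeonhole_subset _ _ J D f.
- move=> C; rewrite !inE /=; apply/andP; split; last first.
    by case: (bipartite e) => //=; exact: implybT.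
  by apply/fintype.subsetP => v; rewrite !inE => /andP[].
- rewrite cardsX card_powerset.
  apply: leq_ltn_trans (_ : _ <= 2 ^ (#|nonroots| + ~~ bipartite e))%N _.
    rewrite expnD leq_mul2l; apply/orP; right.
    case: (bipartite e) => /=; last by rewrite expn1 -card_bool max_card.
    rewrite (_ : [set b | _]%SET = [set false]%SET) ?cards1 //.
    by apply/setP => -[]; rewrite !inE.
  by rewrite ltn_exp2l.
have [/setP fAB1 fAB2] : (f A).1 = (f B).1 /\ (f A).2 = (f B).2 by rewrite fAB.
pose C := ((A :\: B) :|: (B :\: A))%SET.
have nonroot_even v : ~~ roots e v -> ~~ odd (\sum_(k in C) (v \in edge k)).
  move=> rv; have := fAB1 v; rewrite !inE rv /= => h.
  by rewrite odd_sum_symdiff h addbb.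
have all_even v : ~~ odd (\sum_(k in C) (v \in edge k)).
  have [rv|] := boolP (roots e v); last exact: nonroot_even.
  (* An edge has both or neither of its ends in the component of [v], and [v] is the only root
     there. *)
  have : ~~ odd (\sum_(u | connect e v u) \sum_(k in C) (u \in edge k)).
    rewrite exchange_big /=; apply: even_sum => k _.
    have [x [y [exy ->]]] := edgeP k; rewrite (sum_edge _ exy).
    by rewrite (same_connect_r (sym_connect_sym e_sym) (connect1 exy)) addnn odd_double.
  rewrite (bigD1 v) ?connect0 //= oddD.
  suff /negPf-> : ~~ odd (\sum_(u | connect e v u && (u != v))
                            \sum_(k in C) (u \in edge k)) by rewrite addbF.
  apply: even_sum => u /andP[vu uv]; apply: nonroot_even.
  apply: contra uv => ru; rewrite -(eqP ru) -(eqP rv).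
  by rewrite eq_sym root_connect //; exact: sym_connect_sym.
exists C; split=> //.
- by rewrite subUset !(fintype.subset_trans (subsetDl _ _)).
- apply: contra AB; rewrite setU_eq0 !setD_eq0 => /andP[sAB sBA].
  by rewrite eqEsubset sAB.
have [bip|nbip] := boolP (bipartite e); last first.
  have := fAB2; rewrite /= nbip /= -[#|C|]sum1_card odd_sum_symdiff !sum1_card => ->.
  by rewrite addbb.
have /existsP[c /forallP cP] := bip.
suff -> : #|C| = (\sum_(v | c v) \sum_(k in C) (v \in edge k))%N by exact: even_sum.
rewrite exchange_big /= -sum1_card; apply: eq_bigr => k _.
have [x [y [exy ->]]] := edgeP k; rewrite (sum_edge _ exy).
by have /forallP/(_ y) := cP x; rewrite exy /=; case: (c x) (c y) => -[].
Qed.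

(** Modulo I(X_G) this replaces a monomial of large degree by one divisible by the variable of [k0].
    A square of a variable can be traded for the square of that of [k0]; squarefree monomials need
    an even edge set. *)
Lemma parity_exchange (a : 'X_{1..n}) (k0 : 'I_n) :
    (#|nonroots| + ~~ bipartite e <= mdeg a)%N ->
  exists b : 'X_{1..n}, [/\ (0 < b k0)%N, mdeg b = mdeg a &
    forall v, odd (incidence b v) = odd (incidence a v)].
Proof.
move=> ra; have [ak0|ak0] := posnP (a k0); last by exists a.
have [/existsP[k ak]|] := boolP [exists k, 1 < a k]%N.
  have le : (U_(k) *+ 2 <= a)%MM.
    by apply/mnm_lepP => i; rewrite mulmnE mnm1E; case: eqP => [<-|].
  have [g aE] : exists g, a = (g + U_(k) *+ 2)%MM.
    by exists (a - U_(k) *+ 2)%MM; rewrite submK.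
  exists (g + U_(k0) *+ 2)%MM; rewrite aE; split=> [|| v].
  - by rewrite mnmDE [X in (_ + X)%N]mulmnE mnm1E eqxx addn_gt0 orbT.
  - by rewrite ![mdeg (g + _)%MM]mdegD !mdegMn !mdeg1.
  by rewrite ![incidence (g + _)%MM _]incidenceD !incidenceMn !oddD !oddM !andbF.
rewrite negb_exists => /forallP a_le1.
have aE k : a k = (a k == 1%N) :> nat.
  by have := a_le1 k; case: (a k) => [|[|]].
pose A := [set k | a k == 1%N]%SET.
have k0A : k0 \notin A by rewrite inE ak0.
have Aa : #|A| = mdeg a.
  rewrite mdegE -sum1_card big_mkcond; apply: eq_bigr => k _.
  by rewrite inE [RHS]aE; case: eqP.
(* As [a] is squarefree, adding [k0] to its support gives [mdeg a + 1] edges, one more than the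
   bound. *)
have [|C [CJ C0 oddC evenC]] := @even_dependency (k0 |: A)%SET.
  by rewrite cardsU1 k0A Aa.
pose C' := (C :\ k0)%SET.
pose chi := [multinom (k \in C' : nat) | k < n].
have chi_inc v : incidence chi v = (\sum_(k in C') (v \in edge k))%N.
  rewrite [RHS]big_mkcond; apply: eq_bigr => k _.
  by rewrite mnmE; case: ifP; rewrite ?mul1n.
have chi_deg : mdeg chi = #|C'|.
  rewrite mdegE -[#|C'|]sum1_card [RHS]big_mkcond; apply: eq_bigr => k _.
  by rewrite mnmE; case: ifP.
have le : (chi <= a)%MM.
  apply/mnm_lepP => k; rewrite mnmE /C' !inE.
  case: eqP => //= kk0; case: (boolP (k \in C)) => // /(fintype.subsetP CJ).
  by rewrite !inE; case: eqP => //= _ /eqP->.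
have CC' : #|C| = ((k0 \in C) + #|C'|)%N := cardsD1 k0 C.
(* C is nonempty of even size, so it has at least two edges. *)
have C'_gt0 : (0 < #|C'|)%N.
  by move: oddC C0; rewrite -card_gt0 CC'; case: (k0 \in C); case: #|C'|.
have [g gE] : exists g, a = (g + chi)%MM by exists (a - chi)%MM; rewrite submK.
(* [b] arises from [a] by moving the edges of C other than [k0] to [k0]. *)
exists (g + U_(k0) *+ #|C'|)%MM; rewrite gE; split=> [|| v].
- by rewrite mnmDE mulmnE mnm1E eqxx mul1n addn_gt0 C'_gt0 orbT.
- by rewrite !mdegD mdegMn mdeg1 chi_deg mul1n.
rewrite !incidenceD incidenceMn incidence1 chi_inc !oddD.
congr (_ (+) _).
have sumC : (\sum_(k in C) (v \in edge k) =
    (k0 \in C) * (v \in edge k0) + \sum_(k in C') (v \in edge k))%N.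
  have [k0C|k0C] := boolP (k0 \in C); first by rewrite (big_setD1 k0) //= mul1n.
  suff -> : C' = C by [].
  by apply/setP => k; rewrite !inE; case: eqP => // ->; rewrite (negPf k0C).
(* If [k0] is in C, then [#|C'|] is odd and C' meets [v] with the parity of [k0]; otherwise both
   numbers are even. *)
move: (evenC v) oddC; rewrite sumC CC' !oddD !oddM !oddb.
by do 2!case: (_ \in _); case: (odd _); case: (odd _).
Qed.

End ParityExchange.

(** * The ideal I(X_G) and the variable of an edge *)

Section EdgeIdeal.
Variables (K : fieldType) (V : finType) (e : rel V).
Hypotheses (e_sym : symmetric e) (e_irrefl : irreflexive e).
Local Notation n := #|edges e|.
Local Notation x := (xvar K).
Local Notation theta := (@theta V e K).
Local Notation I := (IX e K).

Lemma thetaX (a : 'X_{1..n}) : theta 'X_[a] = \prod_v x v ^+ incidence a v.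
Proof.
rewrite /Defs.theta comp_mpolyX.
transitivity (\prod_(k < n) \prod_v x v ^+ (a k * (v \in edge k))).
  apply: eq_bigr => k _; rewrite tnth_mktuple /edge_image -prodrXl.
  rewrite big_mkcond; apply: eq_bigr => v _ /=.
  by rewrite /edge; case: ifP; rewrite ?muln1 ?muln0.
by rewrite exchange_big; apply: eq_bigr => v _; rewrite prodrXr.
Qed.

Lemma thetaXU (k : 'I_n) u v : e u v -> edge k = [set u; v]%SET ->
  theta 'X_k = x u * x v.
Proof.
move=> euv kE; rewrite thetaX; under eq_bigr do rewrite incidence1 kE.
have uv : u != v by apply: contraTneq euv => ->; rewrite e_irrefl.
rewrite (bigD1 u) //= (bigD1 v) 1?eq_sym //= big1 => [|w].
  by rewrite !inE !eqxx orbT mulr1.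
by rewrite !inE => /andP[/negPf-> /negPf->].
Qed.

Lemma IXD p q : I p -> I q -> I (p + q).
Proof. by rewrite /IX /= /Defs.theta comp_mpolyD; exact: square_diffD. Qed.

Lemma IXM p q : I p -> I (q * p).
Proof. by rewrite /IX /= /Defs.theta rmorphM; exact: square_diffM. Qed.

(** The image of ['X_k] under [theta] is a product of two vertex variables, each a nonzerodivisor
    modulo the square differences. *)
Lemma IX_nzd (k : 'I_n) p : I ('X_k * p) -> I p.
Proof.
have [u [v [euv kE]]] := edgeP k.
rewrite /IX /= /Defs.theta rmorphM /= -/(theta _) (thetaXU euv kE) -mulrA.
by move=> /square_diff_nzd/square_diff_nzd.
Qed.

Lemma IX_binomial (a b : 'X_{1..n}) : mdeg a = mdeg b ->
    (forall v, odd (incidence a v) = odd (incidence b v)) ->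
  I ('X_[a] - 'X_[b]).
Proof.
move=> ab par; rewrite /IX /= /Defs.theta comp_mpolyB -!/(theta _) !thetaX.
by apply: square_diff_congr_mon => //; rewrite !sum_incidence // ab.
Qed.

Lemma IX_homog_mod_var (k : 'I_n) j (p : {mpoly K[n]}) :
    (#|[set v | ~~ roots e v]%SET| + ~~ bipartite e <= j)%N ->
    p \is j.-homog ->
  exists q, I (p - 'X_k * q).
Proof.
move=> rj /dhomogP pj; rewrite [p]mpolyE big_seq.
elim/big_ind: _ => [|p1 p2 [q1 h1] [q2 h2]|a /pj aj].
- by exists 0; rewrite mulr0 subrr /IX /= /Defs.theta comp_mpoly0; exact: square_diff0.
- by exists (q1 + q2); rewrite mulrDr opprD addrACA; exact: IXD.
have [|b [b0 ba bpar]] := parity_exchange e_sym e_irrefl (a := a) k.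
  by rewrite aj.
exists (p@_a *: 'X_[b - U_(k)]); rewrite -scalerAr -mpolyXD addmC.
rewrite submK ?lep1mP -?lt0n //.
by rewrite -scalerBr -mul_mpolyC; apply/IXM/IX_binomial.
Qed.

End EdgeIdeal.

(** * From generator degrees to the regularity bound *)

Theorem proposition4p3 (K : fieldType) (V : finType) (e : rel V)
    (V_nonempty : (0 < #|V|)%N)
    (e_sym : symmetric e) (e_irrefl : irreflexive e)
    (no_isolated : forall x, exists y, e x y) :
  reg_ideal (IX e K) <=
    if bipartite e then #|V|%:Z - (n_comp e V)%:Z
    else #|V|%:Z - (n_comp e V)%:Z + 1.
Proof.
pose N := [set v | ~~ roots e v]%SET.
have compN : (n_comp e V + #|N| = #|V|)%N.
  rewrite -(cardC (roots e)); congr (_ + _)%N; last first.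
    by apply: eq_card => v; rewrite !inE.
  by apply: eq_card => v; rewrite !inE andbT.
have /card_gt0P[u _] := V_nonempty.
have [v euv] := no_isolated u.
(* The two ends of an edge share a component, hence a root, so they are not both roots. *)
have N_gt0 : (0 < #|N|)%N.
  apply/card_gt0P; have [ru|] := boolP (roots e u); last by exists u; rewrite inE.
  exists v; rewrite inE; apply: contraTN (euv) => rv.
  suff -> : u = v by rewrite e_irrefl.
  apply/eqP; rewrite -(eqP ru) -(eqP rv) root_connect; last exact: sym_connect_sym.
  exact: connect1.
have uvE : [set u; v]%SET \in edges e.
  by rewrite inE; apply/existsP; exists u; apply/existsP; exists v; rewrite euv eqxx.
pose k0 : 'I_#|edges e| := enum_rank_in uvE [set u; v]%SET.
suff : reg_quotient (IX e K) < (#|N| + ~~ bipartite e)%N%:Z.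
  by rewrite /reg_ideal; move: compN; case: (bipartite e) => /=; lia.
(* The default value 0 of [reg_quotient] satisfies the strict bound because [N] is nonempty. *)
rewrite /reg_quotient; case: xgetP => [r _ [[i [j [bij ->]]] _]|_]; last by lia.
(* A nonzero Betti number is not the default, so it comes from a minimal resolution with a generator
   of degree [j] in F_i. *)
move: bij; rewrite /betti; case: xgetP => [b _ [F [Fres ->]]|//] /eqP.
rewrite -lt0n => /card_gt0P[k]; rewrite inE => /eqP kj.
have := @gdeg_lt _ _ _ _ Fres (#|N| + ~~ bipartite e) k0 i k.
rewrite kj => h; suff : (j < i + (#|N| + ~~ bipartite e))%N by lia.
apply: h.
- exact: IXD.
- exact: IXM.
- exact: IX_nzd.
- by move=> d p; exact: IX_homog_mod_var.
Qed.
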